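(* For the positive root system $A_n^+$, the combinatorial weight $\overline\omega$ and the weight $\omega$ satisfy $$\overline\omega=\omega+\rho,$$ i.e. $\overline\omega(\sigma)=\omega(\sigma)+\rho$ for all $\sigma\subseteq A_n^+$, where $\rho=(\frac n2,\dots,\frac n2)\in\mathbb R^{n+1}$.
   Context: $A_n^+=\{e_{i,j}\mid0\leq i<j\leq n\}$ is the positive root system of the simple Lie algebra over $\mathbb C$ with Dynkin graph $A_n$, where $e_{i,j}$ is taken to be the vector in $\mathbb R^{n+1}$ (coordinates indexed $0,\dots,n$) whose $i$-th coordinate is $-1$, whose $j$-th coordinate is $1$, and whose other coordinates are $0$. Weight: for $\sigma\subseteq A_n^+$, $\omega(\sigma)=\varrho-\sum_{e\in\sigma}e$, with $\varrho=\frac12\sum_{e\in A_n^+}e$. Combinatorial weight: for $\sigma\subseteq A_n^+$, $\overline\omega(\sigma)=(i_0,i_1,\dots,i_n)$, where for $k=0,\dots,n$, $i_k$ is the number of $t$ (with $k<t\leq n$) such that $e_{k,t}\in\sigma$ plus the number of $s$ (with $0\leq s<k$) such that $e_{s,k}\notin\sigma$. *)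

(* Defs.v *)
From HB Require Import structures.
From mathcomp Require Import all_boot all_order all_algebra finmap reals.
Set Implicit Arguments.
Unset Strict Implicit.
Unset Printing Implicit Defensive.
Import GRing.Theory.
Local Open Scope fset_scope.
Local Open Scope ring_scope.

Definition eroot (R : realType) (n : nat) (i j : 'I_n.+1) : 'rV[R]_n.+1 :=
  \row_k (if k == i then -1 else if k == j then 1 else 0).

Definition Aplus (R : realType) (n : nat) : {fset 'rV[R]_n.+1} :=
  [fset eroot R p.1 p.2 | p : 'I_n.+1 * 'I_n.+1 & (p.1 < p.2)%N].

Definition varrho (R : realType) (n : nat) : 'rV[R]_n.+1 :=
  2^-1 *: \sum_(e <- Aplus R n) e.

Definition weight (R : realType) (n : nat) (sigma : {fset 'rV[R]_n.+1}) :
    'rV[R]_n.+1 :=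
  varrho R n - \sum_(e <- sigma) e.

Definition combcoord (R : realType) (n : nat) (sigma : {fset 'rV[R]_n.+1})
    (k : 'I_n.+1) : nat :=
  (#|[set t : 'I_n.+1 | (k < t)%N && (eroot R k t \in sigma)]|
   + #|[set s : 'I_n.+1 | (s < k)%N && (eroot R s k \notin sigma)]|)%N.

Definition combweight (R : realType) (n : nat) (sigma : {fset 'rV[R]_n.+1}) :
    'rV[R]_n.+1 :=
  \row_k (combcoord sigma k)%:R.

(* Not to be confused with [varrho]: the constant vector (n/2, ..., n/2). *)
Definition rho (R : realType) (n : nat) : 'rV[R]_n.+1 :=
  const_mx (n%:R / 2).

(* Main.v *)
(** The coordinate k of the sum of sigma counts the e_(s,k) in sigma positively
    and the e_(k,t) in sigma negatively. For sigma = A_n^+ this gives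
    varrho_k = (k - (n - k)) / 2, so varrho_k + n / 2 = k, the number of all
    e_(s,k); hence weight + rho at k counts the e_(s,k) outside sigma plus the
    e_(k,t) in sigma. *)
Require Import Defs.
From HB Require Import structures.
From mathcomp Require Import all_boot all_order all_algebra finmap reals.
From mathcomp Require Import ring lra zify.
Import GRing.Theory.
Local Open Scope fset_scope.
Local Open Scope ring_scope.

(** The vector determines its indices: the only coordinate equal to -1 sits at the first index, and
    for [i < j] the only coordinate equal to 1 sits at the second. *)
Lemma eroot_inj (R : realType) (n : nat) :
  {in [pred p : 'I_n.+1 * 'I_n.+1 | (p.1 < p.2)%N] &,
    injective (fun p => eroot R p.1 p.2)}.
Proof.
move=> [i j] [i' j']; rewrite !inE /= => ltij ltij' /rowP E.
have := E i; rewrite !mxE eqxx; case: eqVneq => [? _|_];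
  last by case: ifP => _ ?; exfalso; lra.
subst i'.
have := E j; rewrite !mxE eqxx (gtn_eqF ltij : (j == i) = false).
by case: eqVneq => [->//|_ ?]; exfalso; lra.
Qed.

Lemma mem_Aplus (R : realType) (n : nat) (i j : 'I_n.+1) :
  (i < j)%N -> eroot R i j \in Aplus R n.
Proof. by move=> ltij; apply/imfsetP; exists (i, j). Qed.

(** Strictness matters: for [i = j] the nested conditional gives -1 at [i], while the difference
    vanishes there. *)
Lemma eroot_coord (R : realType) (n : nat) (i j k : 'I_n.+1) : (i < j)%N ->
  eroot R i j 0 k = (j == k)%:R - (i == k)%:R.
Proof.
move=> ltij; rewrite mxE ![k == _]eq_sym.
case: eqVneq => [<-|_].
  by rewrite (gtn_eqF ltij : (j == i) = false) sub0r.
by case: eqVneq => _; rewrite subr0.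
Qed.

(** Passes from vectors to index pairs, over which coordinates can be counted. *)
Lemma sum_roots (R : realType) (n : nat) (sigma : {fset 'rV[R]_n.+1}) :
  sigma `<=` Aplus R n ->
  \sum_(e <- sigma) e =
  \sum_(p : 'I_n.+1 * 'I_n.+1 | (p.1 < p.2)%N && (eroot R p.1 p.2 \in sigma))
     eroot R p.1 p.2.
Proof.
move=> /fsubsetP sub; rewrite -[RHS]big_filter.
set P := filter _ _; rewrite -(big_map (fun p => eroot R p.1 p.2) xpredT id).
have inP p : p \in P = (p.1 < p.2)%N && (eroot R p.1 p.2 \in sigma).
  by rewrite mem_filter mem_index_enum andbT.
(* Both lists are duplicate-free with the same members; for the list of images this rests on
   [eroot_inj]. *)
apply: perm_big; apply: uniq_perm; first exact: fset_uniq.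
  rewrite map_inj_in_uniq ?filter_uniq ?index_enum_uniq // => p q.
  by rewrite !inP => /andP[ltp _] /andP[ltq _]; apply: eroot_inj.
move=> e; apply/idP/mapP => [esigma|[p + ->]]; last by rewrite inP => /andP[].
have /imfsetP[p /= + eE] := sub _ esigma; rewrite inE => ltp.
by exists p; rewrite // inP ltp -eE.
Qed.

Lemma sum_roots_coord (R : realType) (n : nat) (sigma : {fset 'rV[R]_n.+1})
    (k : 'I_n.+1) : sigma `<=` Aplus R n ->
  (\sum_(e <- sigma) e) 0 k =
  #|[set s : 'I_n.+1 | (s < k)%N && (eroot R s k \in sigma)]|%:R
  - #|[set t : 'I_n.+1 | (k < t)%N && (eroot R k t \in sigma)]|%:R.
Proof.
move=> /sum_roots ->; rewrite summxE.
under eq_bigr => p /andP[ltp _] do rewrite eroot_coord //.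
rewrite big_split sumrN /= !cardsE -!sum1_card !natr_sum; congr (_ - _).
  (* With [i] fixed, only [j = k] contributes, so the sum counts the first indices of roots ending
     at [k]. *)
  rewrite big_mkcond -(pair_bigA _ (fun i j : 'I_n.+1 => if (i < j)%N
    && (eroot R i j \in sigma) then (j == k)%:R else 0)) [RHS]big_mkcond /=.
  apply: eq_bigr => i _; rewrite (bigD1 k) //= eqxx big1 ?addr0 //.
  by move=> j /negPf->; rewrite if_same.
(* Here the first index is pinned to [k], so the order of summation is exchanged to make [j] the
   outer variable. *)
rewrite big_mkcond -(pair_bigA _ (fun i j : 'I_n.+1 => if (i < j)%N
  && (eroot R i j \in sigma) then (i == k)%:R else 0)) exchange_big.
rewrite [RHS]big_mkcond /=.
apply: eq_bigr => j _; rewrite (bigD1 k) //= eqxx big1 ?addr0 //.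
by move=> i /negPf->; rewrite if_same.
Qed.

Lemma card_ord_lt (n m : nat) :
  (m <= n)%N -> #|[set s : 'I_n | (s < m)%N]| = m.
Proof.
move=> lemn; rewrite -sum1_card -[RHS]card_ord -sum1_card.
rewrite (big_ord_widen n (fun=> 1%N)) //.
by apply: eq_bigl => s; rewrite inE.
Qed.

(** The reversal [rev_ord], sending t to n - t, matches the indices above [k] with those below n -
    k. *)
Lemma card_ord_gt (n : nat) (k : 'I_n.+1) :
  #|[set t : 'I_n.+1 | (k < t)%N]| = (n - k)%N.
Proof.
rewrite -[RHS](@card_ord_lt n.+1) ?leqW ?leq_subr //.
rewrite -[RHS](card_imset _ rev_ord_inj).
apply: eq_card => s; rewrite -[s]rev_ordK (mem_imset _ _ rev_ord_inj) !inE /=.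
by rewrite !subSS; have := ltn_ord s; have := ltn_ord k; lia.
Qed.

Lemma varrho_coord (R : realType) (n : nat) (k : 'I_n.+1) :
  varrho R n 0 k = k%:R - n%:R / 2.
Proof.
rewrite mxE sum_roots_coord //.
have -> : [set s : 'I_n.+1 | (s < k)%N && (eroot R s k \in Aplus R n)]
    = [set s : 'I_n.+1 | (s < k)%N].
  by apply/setP => s; rewrite !inE; apply: andb_idr => /mem_Aplus.
have -> : [set t : 'I_n.+1 | (k < t)%N && (eroot R k t \in Aplus R n)]
    = [set t : 'I_n.+1 | (k < t)%N].
  by apply/setP => s; rewrite !inE; apply: andb_idr => /mem_Aplus.
rewrite card_ord_lt ?card_ord_gt 1?ltnW // natrB ?leq_ord //; lra.
Qed.

Theorem theorem7p2 (R : realType) (n : nat) (hn : (0 < n)%N)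
    (sigma : {fset 'rV[R]_n.+1}) (hsigma : sigma `<=` Aplus R n) :
  combweight sigma = weight sigma + rho R n.
Proof.
apply/rowP => k; rewrite mxE [RHS]mxE [weight _ _ _]mxE [(- _ : 'rV_ _) _ _]mxE.
rewrite [rho _ _ _ _]mxE varrho_coord sum_roots_coord // /combcoord natrD.
(* The indices below [k] are split by whether [eroot R s k] lies in [sigma]; the count of those
   inside cancels against the one subtracted with the sum of [sigma]. *)
have -> : k%:R = #|[set s : 'I_n.+1 | (s < k)%N && (eroot R s k \in sigma)]|%:R
   + #|[set s : 'I_n.+1 | (s < k)%N && (eroot R s k \notin sigma)]|%:R :> R.
  rewrite -natrD -[in LHS](@card_ord_lt n.+1 k) 1?ltnW //.
  rewrite -(cardsID [set s | eroot R s k \in sigma]).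
  by congr (_ + _)%:R; apply: eq_card => s; rewrite !inE // andbC.
ring.
Qed.
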